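(* Let $G=(V,\vec E,b)$ be a directed weighted graph with vertex measure $m$ satisfying the standing assumptions listed in the context (including Assumption $(\beta)$), and let $\Omega\subset V$ be non-empty. Then $$\frac{h^{2}(\Omega)}{8}\;\le\; M_\Omega\,\nu(\Delta^{D}_\Omega)\;\le\;\frac12\, M_\Omega\, h(\Omega),$$ where $h(\Omega)$ is the Cheeger constant of $\Omega$, $M_\Omega=\sup_{x\in\Omega}\beta^+(x)/m(x)$, and $\nu(\Delta^D_\Omega)=\inf\{\mathrm{Re}\,\lambda:\lambda\in W(\Delta^D_\Omega)\}$ is the bottom of the real part of the numerical range of the Dirichlet Laplacian $\Delta^D_\Omega$.
   Context: A directed weighted graph is $G=(V,\vec E,b)$ with $V$ a countable vertex set and $b:V\times V\to[0,\infty)$ satisfying $b(x,x)=0$ for all $x$ and $b(x,y)>0$ iff $(x,y)\in\vec E$; it carries a measure $m:V\to(0,\infty)$. Put $\beta^+(x)=\sum_{y\in V}b(x,y)$ and $\beta^-(x)=\sum_{y\in V}b(y,x)$. Standing assumptions: $G$ is locally finite (each $x$ has only finitely many $y$ with $b(x,y)>0$ or $b(y,x)>0$); $\beta^+(x)>0$ and $\beta^-(x)>0$ for all $x$; Assumption $(\beta)$: $\beta^+(x)=\beta^-(x)$ for all $x\in V$; $G$ is connected, i.e. any two distinct vertices are related by a path, in one of the two directions (a path from $x$ to $y$ is a finite sequence of directed edges $(x_1,y_1),\dots,(x_n,y_n)\in\vec E$, $n\ge2$, with $x_1=x$, $y_n=y$, $x_i=y_{i-1}$ for $2\le i\le n$).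 $\mathcal C_c(U)$ is the space of finitely supported functions $U\to\mathbb C$. $\ell^2(V,m)$ has inner product $(f,g)_m=\sum_x m(x)f(x)\overline{g(x)}$ (similarly $\ell^2(\Omega,m)$). The Laplacian on $\mathcal C_c(V)$ is $\Delta f(x)=\frac1{m(x)}\sum_{y}b(x,y)(f(x)-f(y))$. For $\Omega\subset V$, the Dirichlet Laplacian $\Delta^D_\Omega$ with domain $\mathcal C_c(\Omega)$ is $\Delta^D_\Omega f=(\Delta g)|_\Omega$, where $g$ is the extension of $f$ by $0$ to $V$. The numerical range is $W(T)=\{(Tf,f): f\in D(T),\ \|f\|=1\}$, with the inner product and norm of $\ell^2(\Omega,m)$ here. The edge boundary of $U\subset V$ is $\partial_E U=\{(x,y)\in\vec E: (x\in U,y\in U^c)\text{ or }(x\in U^c,y\in U)\}$, $b(\partial_EU)=\sum_{(x,y)\in\partial_EU}b(x,y)$, $m(U)=\sum_{x\in U}m(x)$, and $$h(\Omega)=\inf_{\emptyset\ne U\subset\Omega,\ U\text{ finite}}\frac{b(\partial_EU)}{m(U)}.$$ $M_\Omega\in(0,\infty]$; if $M_\Omega=\infty$, products $M_\Omega\cdot t$ with $t\in[0,\infty]$ are read as $\infty$ (also for $t=0$). *)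

(* Defs.v *)
From HB Require Import structures.
From mathcomp Require Import all_boot all_order all_algebra.
From mathcomp Require Import complex.
From mathcomp Require Import boolp classical_sets cardinality fsbigop.
From mathcomp Require Import reals ereal.

Set Implicit Arguments.
Unset Strict Implicit.
Unset Printing Implicit Defensive.

Import Order.TTheory GRing.Theory Num.Theory.

Local Open Scope classical_set_scope.
Local Open Scope ring_scope.
Local Open Scope complex_scope.

(* All sums over sets of vertices or edges are the finitary sums of fsbigop,
   which return 0 when the summand has infinite support. In a locally finite
   graph, with finite vertex sets U and finitely supported functions, every sum
   below has finite support, so this default value is never used. *)

Record wdigraph (R : realType) := WDigraph {
  vertex :> countType;
  edge : set (vertex * vertex);
  weight : vertex -> vertex -> R;
  weight_ge0 : forall x y, 0 <= weight x y;
  weight_diag : forall x, weight x x = 0;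
  weight_gt0 : forall x y, 0 < weight x y <-> edge (x, y)
}.

Section Graph.
Variables (R : realType) (G : wdigraph R).

Definition locally_finite : Prop :=
  forall x : G, finite_set [set y | 0 < weight x y \/ 0 < weight y x].

Definition beta_out (x : G) : R := \sum_(y \in [set: G]) weight x y.

Definition beta_in (x : G) : R := \sum_(y \in [set: G]) weight y x.

(* [p] lists the edges (x_1,y_1), ..., (x_n,y_n) of the path, with n >= 2. *)
Definition dipath (x y : G) (p : seq (G * G)) : Prop :=
  [/\ (2 <= size p)%N,
      forall e, e \in p -> edge e,
      (head (x, y) p).1 = x,
      (last (x, y) p).2 = y
    & sorted (fun e e' : G * G => e'.1 == e.2) p].

Definition connected_digraph : Prop :=
  forall x y : G, x <> y -> (exists p, dipath x y p) \/ (exists p, dipath y x p).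

Definition edge_boundary (U : set G) : set (G * G) :=
  [set e | edge e /\ ((U e.1 /\ ~ U e.2) \/ (~ U e.1 /\ U e.2))].

Definition boundary_weight (U : set G) : R :=
  \sum_(e \in edge_boundary U) weight e.1 e.2.

Definition vol (m : G -> R) (U : set G) : R := \sum_(x \in U) m x.

Definition cheeger (m : G -> R) (Omega : set G) : \bar R :=
  ereal_inf [set (boundary_weight U / vol m U)%:E | U in
    [set U : set G | [/\ U !=set0, U `<=` Omega & finite_set U]]].

Definition max_degree (m : G -> R) (Omega : set G) : \bar R :=
  ereal_sup [set (beta_out x / m x)%:E | x in Omega].

End Graph.

Section HilbertSpace.
Variables (R : realType) (S : choiceType) (m : S -> R).

Definition Cc : set (S -> R[i]) := [set f | finite_set [set x | f x != 0]].

Definition l2dot (f g : S -> R[i]) : R[i] :=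
  \sum_(x \in [set: S]) (m x)%:C * f x * (g x)^*.

Definition l2norm (f : S -> R[i]) : R := Num.sqrt (complex.Re (l2dot f f)).

Definition numerical_range (D : set (S -> R[i]))
    (T : (S -> R[i]) -> (S -> R[i])) : set R[i] :=
  [set l2dot (T f) f | f in [set f | D f /\ l2norm f = 1]].

Definition nu (D : set (S -> R[i])) (T : (S -> R[i]) -> (S -> R[i])) : \bar R :=
  ereal_inf [set (complex.Re l)%:E | l in numerical_range D T].

End HilbertSpace.

Section Laplacian.
Variables (R : realType) (G : wdigraph R) (m : G -> R).

Definition laplacian (f : G -> R[i]) (x : G) : R[i] :=
  ((m x)^-1)%:C * \sum_(y \in [set: G]) (weight x y)%:C * (f x - f y).

Definition ext0 (Omega : set G) (f : set_type Omega -> R[i]) (x : G) : R[i] :=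
  oapp f 0 (insub x : option (set_type Omega)).

Definition dirichlet_laplacian (Omega : set G) (f : set_type Omega -> R[i])
    (x : set_type Omega) : R[i] :=
  laplacian (ext0 f) (val x).

Definition nu_dirichlet (Omega : set G) : \bar R :=
  nu (fun x : set_type Omega => m (val x)) (@Cc R (set_type Omega))
     (@dirichlet_laplacian Omega).

End Laplacian.

(* Product M * t in which M = +oo gives +oo even for t = 0; the library product
   has +oo * 0 = 0. *)
Definition mul_top (R : realType) (M t : \bar R) : \bar R :=
  if M == +oo%E then +oo%E else (M * t)%E.

(* Main.v *)
(** Write [f = u + i v] and [Q f] for the real part of the quadratic form of the
    Dirichlet Laplacian. Since in- and out-degrees agree, [Q f] is half the sum
    of [b x y * `|f x - f y|^2]. Evaluating at the normalised indicator of [U]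
    gives half of [b(dU) / m(U)], hence the upper bound. For the lower bound put
    [w = `|f|^2]: the coarea inequality bounds [h * m(w)] by the sum of
    [b x y * `|w x - w y|], and AM-GM, [2 t `|w x - w y| <= `|f x - f y|^2
    + 2 t^2 (w x + w y)], bounds [2 t] times the latter by
    [2 Q f + 4 t^2 M] when [f] has norm 1; take [t = h / (4 M)]. Every sum is
    taken over a finite sequence [s] that contains the support [r] of [f] and
    all the neighbours of [r]. *)
Require Import Defs.
From HB Require Import structures.
From mathcomp Require Import all_boot all_order all_algebra.
From mathcomp Require Import complex.
From mathcomp Require Import boolp classical_sets cardinality fsbigop.
From mathcomp Require Import reals ereal.
From mathcomp Require Import ring lra.

Set Implicit Arguments.
Unset Strict Implicit.
Unset Printing Implicit Defensive.

Import Order.TTheory GRing.Theory Num.Theory.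

Local Open Scope classical_set_scope.
Local Open Scope ring_scope.

(** * Green's formula, coarea inequality and AM-GM bound for finite sums *)

Section FiniteSums.
Variables (R : realType) (T : eqType) (b : T -> T -> R) (s : seq T).

(** Defined for real functions only: the form of a complex function is half the sum of the energies
    of its real and imaginary parts. The sum runs over ordered pairs. *)
Definition energy (u : T -> R) : R :=
  \sum_(x <- s) \sum_(y <- s) b x y * (u x - u y) ^+ 2.

Hypothesis b_ge0 : forall x y, 0 <= b x y.

Lemma energy_ge0 (u : T -> R) : 0 <= energy u.
Proof.
by do 2![apply: sumr_ge0 => ? _]; rewrite mulr_ge0 ?sqr_ge0.
Qed.

(** Exchanging the sums gives each [w x] its in-degree in place of its out-degree. Balance is asked
    only on the support of [w]: elsewhere the sums over [s] may cut off neighbours and need not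
    agree. *)
Lemma sum_degree (w : T -> R) :
  (forall x, x \in s -> w x != 0 ->
    \sum_(y <- s) b x y = \sum_(y <- s) b y x) ->
  \sum_(x <- s) \sum_(y <- s) b x y * w y =
  \sum_(x <- s) \sum_(y <- s) b x y * w x.
Proof.
move=> bal; rewrite exchange_big; apply: eq_big_seq => x xs /=.
rewrite -!mulr_suml; have [->|wx] := eqVneq (w x) 0; first by rewrite !mulr0.
by rewrite bal.
Qed.

(** Pointwise, [(p - q)^2 = 2 (p - q) p + q^2 - p^2]; the last two terms cancel in the sum by
    [sum_degree] for [u^2]. Balance thus replaces symmetry of [b]. *)
Lemma green (u : T -> R) :
  (forall x, x \in s -> u x != 0 ->
    \sum_(y <- s) b x y = \sum_(y <- s) b y x) ->
  \sum_(x <- s) \sum_(y <- s) b x y * ((u x - u y) * u x) = 2^-1 * energy u.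
Proof.
move=> bal; have -> : energy u =
    2 * (\sum_(x <- s) \sum_(y <- s) b x y * ((u x - u y) * u x))
    + (\sum_(x <- s) \sum_(y <- s) b x y * u y ^+ 2
       - \sum_(x <- s) \sum_(y <- s) b x y * u x ^+ 2).
  rewrite /energy mulr_sumr -sumrB -big_split; apply: eq_bigr => x _ /=.
  rewrite mulr_sumr -sumrB -big_split; apply: eq_bigr => y _ /=; ring.
rewrite (sum_degree (w := fun x => u x ^+ 2)); first by field.
by move=> x xs; rewrite sqrf_eq0; exact: bal.
Qed.

(* Peel off the smallest positive level of [g]: with [c] its value and [P] the
   support, [g = (g - c)^+ + c 1_P] on [s], and the two parts add up in
   [`|g x - g y|] because both vanish off [P]. *)
Lemma coarea (m : T -> R) (h : R) (g : T -> R) :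
  (forall x, 0 <= g x) ->
  (forall P : pred T, has P s -> (forall x, P x -> g x != 0) ->
     h * \sum_(x <- s) m x * (P x)%:R <=
     \sum_(x <- s) \sum_(y <- s) b x y * (P x (+) P y)%:R) ->
  h * \sum_(x <- s) m x * g x <=
  \sum_(x <- s) \sum_(y <- s) b x y * `|g x - g y|.
Proof.
(* Induction on the number of entries of [s] at which [g] is nonzero. *)
have [n] := ubnP (count (fun x => g x != 0) s).
elim: n g => // n IHn g; rewrite ltnS => gn g_ge0 hP.
pose P : pred T := fun x => g x != 0.
have [sP|/hasPn noP] := boolP (has P s); last first.
  rewrite big1_seq ?mulr0.
    by do 2![apply: sumr_ge0 => ? _]; rewrite mulr_ge0.
  by move=> x /andP[_ /noP]; rewrite negbK => /eqP ->; rewrite mulr0.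
(* A minimiser of [g] on its support in [s], found by induction on [s]. *)
have [x0 [x0s Px0 x0min]] :
    exists x0, [/\ x0 \in s, P x0 & forall x, x \in s -> P x -> g x0 <= g x].
  elim: (s) sP => //= z t IHt.
  have [/IHt [x1 [x1t Px1 x1min]] _|ht] := boolP (has P t).
    have [Pz|nPz] := boolP (P z); last first.
      exists x1; split=> //; first by rewrite inE x1t orbT.
      by move=> x /[!inE] /orP[/eqP ->|]; [rewrite (negPf nPz)|exact: x1min].
    have [zx1|x1z] := leP (g z) (g x1).
      exists z; split=> //; first by rewrite inE eqxx.
      move=> x /[!inE] /orP[/eqP -> //|xt Px].
      exact: le_trans zx1 (x1min _ xt Px).
    exists x1; split=> //; first by rewrite inE x1t orbT.
    by move=> x /[!inE] /orP[/eqP -> _|]; [exact: ltW|exact: x1min].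
  rewrite orbF => Pz; exists z; split=> //; first by rewrite inE eqxx.
  move=> x /[!inE] /orP[/eqP -> //|xt Px].
  by move/hasPn: ht => /(_ _ xt); rewrite Px.
set c := g x0 in x0min.
have c_gt0 : 0 < c by rewrite lt0r g_ge0 andbT.
pose g' x := Num.max 0 (g x - c).
have g'P x : g' x != 0 -> P x.
  rewrite /g' /P; apply: contraNneq => ->.
  by rewrite sub0r max_l// oppr_le0 ltW.
have gE x : x \in s -> g x = g' x + c * (P x)%:R.
  move=> xs; rewrite /g'; have [Px|] := boolP (P x).
    by rewrite max_r ?subr_ge0 ?x0min// mulr1 subrK.
  by rewrite negbK => /eqP ->; rewrite sub0r max_l ?oppr_le0 ?ltW// mulr0 addr0.
have g'_ge0 x : 0 <= g' x by rewrite le_max lexx.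
have g'0 x : ~~ P x -> g' x = 0 by move=> /(contraNN (@g'P x))/negPn/eqP.
have -> : \sum_(x <- s) m x * g x =
    \sum_(x <- s) m x * g' x + c * \sum_(x <- s) m x * (P x)%:R.
  rewrite mulr_sumr -big_split; apply: eq_big_seq => x /gE -> /=; ring.
have -> : \sum_(x <- s) \sum_(y <- s) b x y * `|g x - g y| =
    \sum_(x <- s) \sum_(y <- s) b x y * `|g' x - g' y| +
    c * \sum_(x <- s) \sum_(y <- s) b x y * (P x (+) P y)%:R.
  rewrite mulr_sumr -big_split; apply: eq_big_seq => x xs /=.
  rewrite mulr_sumr -big_split; apply: eq_big_seq => y ys /=.
  rewrite !gE// mulrCA -mulrDr; congr (_ * _).
  have [Px|/g'0 ->] := boolP (P x); have [Py|/g'0 ->] := boolP (P y) => /=.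
  - by rewrite opprD addrACA subrr addr0 mulr0 addr0.
  - by rewrite !mulr0 !mulr1 addr0 !subr0 !ger0_norm// addr_ge0// ltW.
  - rewrite !mulr0 !mulr1 addr0 !sub0r !normrN !ger0_norm//.
    by rewrite addr_ge0// ltW.
  - by rewrite !mulr0 !addr0.
rewrite mulrDr lerD//; last by rewrite mulrCA ler_pM2l//; exact: hP.
(* The hypothesis on sets is inherited by [g'], whose support lies in [P]. *)
apply: IHn => //; last by move=> Q Qs Qg; apply: hP => // x /Qg /g'P.
apply: leq_trans gn.
(* The count drops strictly: [x0] lies in [P] but [g' x0 = 0]. *)
pose Q x := g' x != 0.
rewrite -[X in (_ < X)%N](size_filter P) -(count_predC Q) !count_filter.
rewrite (eq_count (a2 := predI Q P)); last first.
  by move=> x /=; rewrite /Q andb_idr//; exact: g'P.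
rewrite -addn1 leq_add2l -has_count; apply/hasP; exists x0 => //=.
by rewrite Px0 andbT negbK /g' subrr maxxx.
Qed.

(* AM-GM in the form [2 t `|p^2 - q^2| <= (p - q)^2 + t^2 (p + q)^2] *)
Lemma sum_diff_sqr_le (u v : T -> R) (t : R) :
  (forall x, x \in s -> u x ^+ 2 + v x ^+ 2 != 0 ->
    \sum_(y <- s) b x y = \sum_(y <- s) b y x) ->
  0 <= t ->
  2 * t * \sum_(x <- s) \sum_(y <- s)
     b x y * `|(u x ^+ 2 + v x ^+ 2) - (u y ^+ 2 + v y ^+ 2)| <=
  energy u + energy v
  + 4 * t ^+ 2 * \sum_(x <- s) \sum_(y <- s) b x y * (u x ^+ 2 + v x ^+ 2).
Proof.
move=> bal t0; set w := fun x => u x ^+ 2 + v x ^+ 2 in bal *.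
(* Balance symmetrises the degree term, so that the inequality can be proved pair by pair. *)
have -> : 4 * t ^+ 2 * \sum_(x <- s) \sum_(y <- s) b x y * w x =
    2 * t ^+ 2 * (\sum_(x <- s) \sum_(y <- s) b x y * w x
                  + \sum_(x <- s) \sum_(y <- s) b x y * w y).
  by rewrite sum_degree//; ring.
rewrite /energy -!big_split !mulr_sumr -big_split; apply: ler_sum => x _ /=.
rewrite -!big_split !mulr_sumr -big_split; apply: ler_sum => y _ /=.
rewrite -!mulrDr [_ * (b x y * _)]mulrCA [2 * t ^+ 2 * _]mulrCA -mulrDr.
apply: ler_wpM2l => //; rewrite /w.
set p := u x; set q := v x; set p' := u y; set q' := v y.
(* For either sign inside the absolute value, the gap between the two sides is a sum of four
   squares. *)
rewrite -[2 * t]ger0_norm ?mulr_ge0// -normrM ler_norml; apply/andP; split.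
  rewrite -subr_ge0 opprK.
  have -> : 2 * t * (p ^+ 2 + q ^+ 2 - (p' ^+ 2 + q' ^+ 2))
      + ((p - p') ^+ 2 + (q - q') ^+ 2
         + 2 * t ^+ 2 * (p ^+ 2 + q ^+ 2 + (p' ^+ 2 + q' ^+ 2))) =
      (p - p' + t * (p + p')) ^+ 2 + (q - q' + t * (q + q')) ^+ 2
      + ((t * (p - p')) ^+ 2 + (t * (q - q')) ^+ 2) by ring.
  by rewrite !addr_ge0 ?sqr_ge0.
rewrite -subr_ge0.
have -> : (p - p') ^+ 2 + (q - q') ^+ 2
    + 2 * t ^+ 2 * (p ^+ 2 + q ^+ 2 + (p' ^+ 2 + q' ^+ 2))
    - 2 * t * (p ^+ 2 + q ^+ 2 - (p' ^+ 2 + q' ^+ 2)) =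
    (p - p' - t * (p + p')) ^+ 2 + (q - q' - t * (q + q')) ^+ 2
    + ((t * (p - p')) ^+ 2 + (t * (q - q')) ^+ 2) by ring.
by rewrite !addr_ge0 ?sqr_ge0.
Qed.

End FiniteSums.

(** * Finitary sums as sums over sequences *)

Lemma fsum_seq (M : nmodType) (T : choiceType) (A : set T) (r : seq T)
    (F : T -> M) :
  uniq r -> (forall x, A x -> x \notin r -> F x = 0) ->
  \sum_(x \in A) F x = \sum_(x <- r | x \in A) F x.
Proof.
move=> ur F0; rewrite [RHS]bigfs//.
  by apply: eq_fsbigl; apply/seteqP; split=> x /=; rewrite inE.
by move=> x; rewrite inE; exact: F0.
Qed.

Lemma fsum_set_type (M : nmodType) (T : choiceType) (A : set T) (F : T -> M) :
  \sum_(x \in [set: set_type A]) F (val x) = \sum_(x \in A) F x.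
Proof.
rewrite [RHS](reindex_fsbig (val : set_type A -> T) [set: set_type A])//.
split=> [x _|x y _ _|x Ax]; first exact: set_valP.
  exact: val_inj.
by exists (exist _ x (mem_set Ax)).
Qed.

(** * Reduction of the graph quantities to a finite neighbourhood *)

Section DirichletForm.
Variables (R : realType) (G : wdigraph R).
Hypothesis G_lf : locally_finite G.
Hypothesis beta_eq : forall x : G, beta_out x = beta_in x.

(** Neighbours in both directions are included, so that in- and out-degrees at points of [r] are
    full sums over [s]. Points of [s] outside [r] may still have neighbours outside [s]. *)
Definition nbhd_seq (r s : seq G) : Prop :=
  [/\ uniq s, {subset r <= s} &
      forall x y, x \in r -> 0 < weight x y \/ 0 < weight y x -> y \in s].

Lemma nbhd_seq_exists (r : seq G) : exists s, nbhd_seq r s.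
Proof.
elim: r => [|x r [s [us rs ns]]]; first by exists [::].
have /finite_seqP[t tE] := G_lf x.
exists (undup (x :: t ++ s)); split; first exact: undup_uniq.
  move=> y /[!(inE, mem_undup, mem_cat)] /orP[->//|/rs ->].
  by rewrite !orbT.
move=> z y /[!(inE, mem_undup, mem_cat)] /orP[/eqP -> wxy|zr wzy].
  have : [set` t] y by rewrite -tE.
  by move=> /= ->; rewrite orbT.
by rewrite (ns _ _ zr wzy) !orbT.
Qed.

Section Neighbourhood.
Variables (r s : seq G).
Hypothesis rs : nbhd_seq r s.

Lemma weight_notin (x y : G) : x \in r -> y \notin s ->
  weight x y = 0 /\ weight y x = 0.
Proof.
have [_ _ ns] := rs.
move=> xr ys; split; apply/eqP; rewrite eq_le weight_ge0 andbT leNgt.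
  by apply: contraNN ys => wxy; apply: ns xr _; left.
by apply: contraNN ys => wxy; apply: ns xr _; right.
Qed.

Lemma beta_out_seq (x : G) : x \in r -> beta_out x = \sum_(y <- s) weight x y.
Proof.
move=> xr; rewrite /beta_out (fsum_seq (r := s)); first 1 last.
- by have [] := rs.
- by move=> y _ /(weight_notin xr)[].
by apply: eq_bigl => y; rewrite in_setT.
Qed.

Lemma beta_in_seq (x : G) : x \in r -> beta_in x = \sum_(y <- s) weight y x.
Proof.
move=> xr; rewrite /beta_in (fsum_seq (r := s)); first 1 last.
- by have [] := rs.
- by move=> y _ /(weight_notin xr)[].
by apply: eq_bigl => y; rewrite in_setT.
Qed.

Lemma balanced_seq (x : G) : x \in r ->
  \sum_(y <- s) weight x y = \sum_(y <- s) weight y x.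
Proof. by move=> xr; rewrite -beta_out_seq// -beta_in_seq. Qed.

Lemma vol_seq (m : G -> R) (U : set G) : (forall x, U x -> x \in r) ->
  vol m U = \sum_(x <- s) m x * (x \in U)%:R.
Proof.
have [us sub_rs _] := rs.
move=> Ur; rewrite /vol (fsum_seq (r := s))//; last first.
  by move=> x /Ur /sub_rs ->.
rewrite big_mkcond; apply: eq_bigr => x _.
by case: ifP => _; rewrite (mulr1, mulr0).
Qed.

(** An edge crosses the boundary of [U], in either direction, exactly when the exclusive or holds.
    One endpoint is then in [r], hence both are in [s]. *)
Lemma boundary_weight_seq (U : set G) : (forall x, U x -> x \in r) ->
  boundary_weight U = \sum_(x <- s) \sum_(y <- s)
    weight x y * ((x \in U) (+) (y \in U))%:R.
Proof.
have [us sub_rs ns] := rs => Ur.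
rewrite /boundary_weight (fsum_seq (r := [seq (x, y) | x <- s, y <- s])).
- rewrite big_mkcond big_allpairs; apply: eq_bigr => x _.
  apply: eq_bigr => y _ /=.
  have [xyE|/negP nE] := boolP ((x, y) \in edge_boundary U).
    suff -> : (x \in U) (+) (y \in U) by rewrite mulr1.
    move: xyE; rewrite inE /edge_boundary /= => -[_ [[Ux Uy]|[Ux Uy]]].
      by rewrite (mem_set Ux) (memNset Uy).
    by rewrite (mem_set Uy) (memNset Ux).
  (* A pair outside the edge boundary either has weight 0 or is an edge with both ends on the same
     side of [U]. *)
  have := weight_ge0 x y; rewrite le_eqVlt => /predU1P[<-|wxy].
    by rewrite mul0r.
  suff -> : (x \in U) (+) (y \in U) = false by rewrite mulr0.
  apply/negP => xUy; apply: nE; rewrite inE; split; first exact/weight_gt0.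
  move: xUy; have [Ux|Ux] := boolP (x \in U); have [Uy|Uy] := boolP (y \in U).
  - by [].
  - by left; split; [exact: set_mem|move/mem_set; rewrite (negPf Uy)].
  - by right; split; [move/mem_set; rewrite (negPf Ux)|exact: set_mem].
  - by [].
- by apply: allpairs_uniq => // -[x y] [x' y'].
move=> [x y] /= [/weight_gt0 wxy Uxy] /negP; case; apply/allpairsP.
exists (x, y); split=> //=.
  by case: Uxy => /= -[Ux Uy]; [exact/sub_rs/Ur|apply: (ns y); [exact: Ur|right]].
by case: Uxy => /= -[Ux Uy]; [apply: (ns x); [exact: Ur|left]|exact/sub_rs/Ur].
Qed.

(** The measure cancels the factor [1/m] of the Laplacian. With [g = u + i v], the real part of
    [(g x - g y) * (g x)^*] is [(u x - u y) u x + (v x - v y) v x], and [green] applies to each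
    part. *)
Lemma dirichlet_form_seq (m : G -> R) (Omega : set G) (g : G -> R[i]) :
  (forall x, 0 < m x) ->
  (forall x, g x != 0 -> x \in r) -> (forall x, g x != 0 -> Omega x) ->
  complex.Re (\sum_(x \in Omega) (m x)%:C%C * laplacian m g x * (g x)^*) =
  2^-1 * (energy (@weight R G) s (fun x => complex.Re (g x))
          + energy (@weight R G) s (fun x => complex.Im (g x))).
Proof.
move=> m_gt0 gr gO; have [us sub_rs ns] := rs.
rewrite (fsum_seq (r := s))//; last first.
  move=> x _ xs; suff -> : g x = 0 by rewrite conjC0 mulr0.
  by apply/eqP; apply: contraNT xs => /gr /sub_rs.
rewrite raddf_sum big_mkcond mulrDr -!green; first 1 last.
- by move=> x _ gx; apply: balanced_seq; apply: gr; apply: contraNneq gx => ->.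
- by move=> x _ gx; apply: balanced_seq; apply: gr; apply: contraNneq gx => ->.
rewrite -big_split; apply: eq_bigr => x _ /=.
rewrite -big_split /=.
(* Both sides vanish where [g x = 0]; otherwise [x] is in [r], and the Laplacian at [x] is a sum
   over [s]. *)
have [gx0|gx] := eqVneq (g x) 0.
  rewrite gx0 conjC0 mulr0 if_same big1// => y _.
  by rewrite !mulr0 addr0.
rewrite mem_set ?gO//; last exact: gO.
have xr := gr _ gx.
rewrite /laplacian (fsum_seq (r := s))//; last first.
  by move=> y _ /(weight_notin xr)[-> _]; rewrite mul0r.
rewrite mulrA -rmorphM /= divff ?gt_eqF//.
rewrite mul1r mulr_suml raddf_sum; apply: eq_big => [y|y _]; first by rewrite in_setT.
case: (g x) (g y) => [a1 a2] [b1 b2] /=; ring.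
Qed.

End Neighbourhood.

(** * Bounds on the numerical range of the Dirichlet Laplacian *)

Section Dirichlet.
Variables (m : G -> R) (Omega : set G).
Hypothesis m_gt0 : forall x, 0 < m x.

Lemma ext0_val (f : set_type Omega -> R[i]) (x : set_type Omega) :
  ext0 f (val x) = f x.
Proof. by rewrite /ext0 valK. Qed.

Lemma ext0_neq0 (f : set_type Omega -> R[i]) (x : G) :
  ext0 f x != 0 -> exists2 y : set_type Omega, val y = x & f y != 0.
Proof.
by rewrite /ext0; case: insubP => [y _ <-|_] /=; [exists y|rewrite eqxx].
Qed.

Lemma l2dot_ext0 (f : set_type Omega -> R[i]) :
  l2dot (fun x : set_type Omega => m (val x)) f f =
  \sum_(x \in Omega) (m x)%:C%C * ext0 f x * (ext0 f x)^*.
Proof.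
rewrite -fsum_set_type; apply: eq_fsbigr => x _.
by rewrite !ext0_val.
Qed.

Lemma l2dot_dirichlet (f : set_type Omega -> R[i]) :
  l2dot (fun x : set_type Omega => m (val x)) (dirichlet_laplacian m f) f =
  \sum_(x \in Omega) (m x)%:C%C * laplacian m (ext0 f) x * (ext0 f x)^*.
Proof.
rewrite -fsum_set_type; apply: eq_fsbigr => x _.
by rewrite !ext0_val.
Qed.

Lemma Cc_nbhd_seq (f : set_type Omega -> R[i]) : Cc f ->
  exists r s, [/\ nbhd_seq r s, {subset r <= Omega}
                & forall x, ext0 f x != 0 -> x \in r].
Proof.
move=> /finite_seqP[t tE].
have [s rs] := nbhd_seq_exists [seq val x | x <- t].
exists [seq val x | x <- t], s; split=> // x.
  by move=> /mapP[y _ ->]; exact: valP.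
by move=> /ext0_neq0[y <- fy]; apply: map_f; have : [set` t] y by rewrite -tE.
Qed.

Lemma sqnorm_seq (r s : seq G) (g : G -> R[i]) : nbhd_seq r s ->
  (forall x, g x != 0 -> x \in r) -> (forall x, g x != 0 -> Omega x) ->
  complex.Re (\sum_(x \in Omega) (m x)%:C%C * g x * (g x)^*) =
  \sum_(x <- s) m x * (complex.Re (g x) ^+ 2 + complex.Im (g x) ^+ 2).
Proof.
move=> [us sub_rs _] gr gO.
rewrite (fsum_seq (r := s))//; last first.
  move=> x _ xs; suff -> : g x = 0 by rewrite mulr0 mul0r.
  by apply/eqP; apply: contraNT xs => /gr /sub_rs.
rewrite raddf_sum big_mkcond; apply: eq_bigr => x _ /=.
have [gx0|gx] := eqVneq (g x) 0.
  by rewrite gx0 conjC0 mulr0 if_same /= expr0n addr0 mulr0.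
rewrite mem_set; last exact: gO.
by case: (g x) => [a1 a2] /=; ring.
Qed.

(** Ensures that the infimum [nu] is not [-oo]. *)
Lemma numerical_range_ge0 (f : set_type Omega -> R[i]) : Cc f ->
  0 <= complex.Re (l2dot (fun x : set_type Omega => m (val x))
                     (dirichlet_laplacian m f) f).
Proof.
move=> /Cc_nbhd_seq[r [s [rs rO fr]]].
rewrite l2dot_dirichlet (dirichlet_form_seq rs)//.
  rewrite mulr_ge0 ?invr_ge0// addr_ge0// energy_ge0// => x y;
    exact: weight_ge0.
by move=> x /fr /rO /set_mem.
Qed.

(* The parameter of [sum_diff_sqr_le] is optimal at [h / (4 M)]. *)
Lemma numerical_range_lower (h M : R) (f : set_type Omega -> R[i]) :
  0 <= h -> 0 < M ->
  (forall U, U !=set0 -> U `<=` Omega -> finite_set U ->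
     h * vol m U <= boundary_weight U) ->
  (forall x, Omega x -> beta_out x <= M * m x) ->
  Cc f -> l2norm (fun x : set_type Omega => m (val x)) f = 1 ->
  h ^+ 2 * 8^-1 <=
  M * complex.Re (l2dot (fun x : set_type Omega => m (val x))
                    (dirichlet_laplacian m f) f).
Proof.
move=> h_ge0 M_gt0 hU betaM fc; have [r [s [rs rO fr]]] := Cc_nbhd_seq fc.
have fO x : ext0 f x != 0 -> Omega x by move=> /fr /rO /set_mem.
rewrite l2dot_dirichlet (dirichlet_form_seq rs)//.
rewrite /l2norm l2dot_ext0 (sqnorm_seq rs)// => normf.
set g := ext0 f in fr fO normf *.
pose u x := complex.Re (g x); pose v x := complex.Im (g x).
rewrite -/u -/v; pose w x := u x ^+ 2 + v x ^+ 2.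
have w_ge0 x : 0 <= w x by rewrite addr_ge0 ?sqr_ge0.
have wg x : w x != 0 -> g x != 0.
  by apply: contraNneq => gx; rewrite /w /u /v gx /= expr0n addr0.
have {}normf : \sum_(x <- s) m x * w x = 1.
  have : Num.sqrt (\sum_(x <- s) m x * w x) ^+ 2 = 1 by rewrite normf expr1n.
  rewrite sqr_sqrtr//; apply: sumr_ge0 => x _.
  by rewrite mulr_ge0// ltW.
have b_ge0 := @weight_ge0 R G.
(* Since [m(w) = 1], this is the coarea inequality for [w]; each set [P] in the support of [w] is a
   finite subset of [Omega], so [hU] applies. *)
have coa : h <= \sum_(x <- s) \sum_(y <- s) weight x y * `|w x - w y|.
  rewrite -[leLHS]mulr1 -normf; apply: coarea => // P sP Pw.
  have Pr x : [set` P] x -> x \in r by move=> /Pw/wg/fr.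
  have PE x : (x \in [set` P]) = P x by rewrite mem_setE.
  have := hU [set` P].
  rewrite (vol_seq rs)// (boundary_weight_seq rs)//.
  under eq_bigr do rewrite PE.
  under [X in _ <= X]eq_bigr do under eq_bigr do rewrite !PE.
  apply.
  - by have /hasP[x _ Px] := sP; exists x.
  - by move=> x /Pw/wg/fO.
  - apply: sub_finite_set (finite_seq r); exact: Pr.
have bal x : x \in s -> w x != 0 ->
    \sum_(y <- s) weight x y = \sum_(y <- s) weight y x.
  by move=> _ /wg/fr; exact: balanced_seq.
have deg : \sum_(x <- s) \sum_(y <- s) weight x y * w x <= M.
  rewrite -[leRHS]mulr1 -normf mulr_sumr; apply: ler_sum => x _.
  rewrite -mulr_suml; have [->|wx] := eqVneq (w x) 0; first by rewrite !mulr0.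
  rewrite mulrA ler_wpM2r// -(beta_out_seq rs); first exact/betaM/fO/wg.
  exact/fr/wg.
pose t := h / (4 * M).
have t_ge0 : 0 <= t by rewrite divr_ge0// mulr_ge0// ltW.
have := sum_diff_sqr_le b_ge0 bal t_ge0.
have : 2 * t * h <=
    2 * t * \sum_(x <- s) \sum_(y <- s) weight x y * `|w x - w y|.
  by rewrite ler_wpM2l// mulr_ge0.
move=> /le_trans /[apply] H.
have {H} : 2 * t * h <= energy (@weight R G) s u + energy (@weight R G) s v
    + 4 * t ^+ 2 * M.
  by apply: le_trans H _; rewrite lerD2l ler_wpM2l// mulr_ge0 ?sqr_ge0.
set En := energy _ _ _ + _ => H.
(* With [t = h / (4 M)] this reads [h^2 / 2 <= M * En + h^2 / 4]; halving [h^2 / 4 <= M * En] gives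
   the constant 1/8. *)
have {H} : M * (2 * t * h) <= M * (En + 4 * t ^+ 2 * M) by rewrite ler_pM2l.
have -> : M * (2 * t * h) = h ^+ 2 / 2 by rewrite /t; field; rewrite gt_eqF.
have -> : M * (En + 4 * t ^+ 2 * M) = M * En + h ^+ 2 / 4.
  by rewrite /t; field; rewrite gt_eqF.
lra.
Qed.

Lemma vol_gt0 (U : set G) : U !=set0 -> finite_set U -> 0 < vol m U.
Proof.
move=> [x Ux] Uf; rewrite /vol (fsbigD1 x)// ltr_pwDl//.
by rewrite sumr_ge0// => y _; exact: ltW.
Qed.

(** The test function [c 1_U] is real, and [(1_U x - 1_U y)^2] is 1 exactly when one of [x], [y]
    lies in [U]. Its energy is therefore [c^2] times the boundary weight. *)
Lemma numerical_range_indicator (U : set G) :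
  U !=set0 -> U `<=` Omega -> finite_set U ->
  exists f : set_type Omega -> R[i],
    [/\ Cc f, l2norm (fun x : set_type Omega => m (val x)) f = 1
      & complex.Re (l2dot (fun x : set_type Omega => m (val x))
                      (dirichlet_laplacian m f) f) =
        2^-1 * (boundary_weight U / vol m U)].
Proof.
move=> U0 UO Uf; have volU := vol_gt0 U0 Uf.
pose c := (Num.sqrt (vol m U))^-1.
have c2 : c ^+ 2 = (vol m U)^-1 by rewrite exprVn sqr_sqrtr// ltW.
pose f (x : set_type Omega) : R[i] := (c * (val x \in U)%:R)%:C%C.
have fE x : ext0 f x = (c * (x \in U)%:R)%:C%C.
  rewrite /ext0; case: insubP => [y _ <- //|nO] /=.
  by rewrite memNset ?mulr0// => /UO/mem_set; rewrite (negPf nO).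
have gU x : ext0 f x != 0 -> U x.
  by have [//|nU] := pselect (U x); rewrite fE memNset// mulr0 eqxx.
have /finite_seqP[r rE] := Uf.
have [s rs] := nbhd_seq_exists r.
have Ur x : U x -> x \in r by rewrite rE.
have fr x : ext0 f x != 0 -> x \in r by move=> /gU/Ur.
have fO x : ext0 f x != 0 -> Omega x by move=> /gU/UO.
exists f; split.
- apply: (@sub_finite_set _ _ (val @^-1` U)).
    by move=> x /= fx; apply: gU; rewrite ext0_val.
  by apply: finite_preimage => // x y _ _; exact: val_inj.
- rewrite /l2norm l2dot_ext0 (sqnorm_seq rs)//.
  have -> : \sum_(x <- s) m x * (complex.Re (ext0 f x) ^+ 2
      + complex.Im (ext0 f x) ^+ 2) = c ^+ 2 * vol m U.
    rewrite (vol_seq rs)// mulr_sumr; apply: eq_bigr => x _.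
    by rewrite fE /=; case: (x \in U) => /=; ring.
  by rewrite c2 mulVf ?gt_eqF// sqrtr1.
- rewrite l2dot_dirichlet (dirichlet_form_seq rs)//; congr (_ * _).
  rewrite (boundary_weight_seq rs)// [RHS]mulrC -c2 mulr_sumr -big_split.
  apply: eq_bigr => x _ /=; rewrite mulr_sumr -big_split; apply: eq_bigr => y _.
  by rewrite !fE /=; case: (x \in U); case: (y \in U) => /=; ring.
Qed.

End Dirichlet.
End DirichletForm.

(** * Assembly of both bounds in the extended reals *)

Theorem theorem3p1 (R : realType) (G : wdigraph R) (m : G -> R)
    (m_gt0 : forall x : G, 0 < m x)
    (G_lf : locally_finite G)
    (beta_out_gt0 : forall x : G, 0 < beta_out x)
    (beta_in_gt0 : forall x : G, 0 < beta_in x)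
    (beta_eq : forall x : G, beta_out x = beta_in x)
    (G_conn : connected_digraph G)
    (Omega : set G) (Omega_neq0 : Omega !=set0) :
  ((cheeger m Omega ^+ 2 * (8^-1)%:E
      <= mul_top (max_degree m Omega) (nu_dirichlet m Omega))%E
   /\ (mul_top (max_degree m Omega) (nu_dirichlet m Omega)
      <= (2^-1)%:E * mul_top (max_degree m Omega) (cheeger m Omega))%E).
Proof.
have [x0 Ox0] := Omega_neq0.
pose h' := cheeger m Omega; pose n' := nu_dirichlet m Omega.
have hU U : U !=set0 -> U `<=` Omega -> finite_set U ->
    (h' <= (boundary_weight U / vol m U)%:E)%E.
  by move=> U0 UO Uf; apply: ereal_inf_lbound; exists U.
have nU U : U !=set0 -> U `<=` Omega -> finite_set U ->
    (n' <= (2^-1 * (boundary_weight U / vol m U))%:E)%E.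
  move=> U0 UO Uf; apply: ereal_inf_lbound.
  have [f [fc nf <-]] := numerical_range_indicator G_lf beta_eq m_gt0 U0 UO Uf.
  by eexists; [exists f|].
have x0O : [set x0] `<=` Omega by move=> _ ->.
have x0N : [set x0] !=set0 by exists x0.
have h_ge0 : (0 <= h')%E.
  apply: le_ereal_inf_tmp => _ [U [U0 UO Uf] <-].
  rewrite lee_fin divr_ge0 ?sumr_ge0// => x _; first exact: weight_ge0.
  exact: ltW.
have n_ge0 : (0 <= n')%E.
  apply: le_ereal_inf_tmp => _ [_ [f [fc _] <-] <-].
  by rewrite lee_fin numerical_range_ge0.
(* The singleton of [x0] is a competitor, which makes both infima finite. *)
have [h hE] : exists h, h' = h%:E.
  have /fineK <- : h' \is a fin_num; last by eexists.
  rewrite ge0_fin_numE//.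
  exact: le_lt_trans (hU _ x0N x0O (finite_set1 _)) (ltry _).
have [n nE] : exists n, n' = n%:E.
  have /fineK <- : n' \is a fin_num; last by eexists.
  rewrite ge0_fin_numE//.
  exact: le_lt_trans (nU _ x0N x0O (finite_set1 _)) (ltry _).
(* [2 n] is a lower bound of all the Cheeger quotients. *)
have n_le : n <= 2^-1 * h.
  suff : ((2 * n)%:E <= h')%E by rewrite hE lee_fin; lra.
  apply: le_ereal_inf_tmp => _ [U [U0 UO Uf] <-].
  by have := nU U U0 UO Uf; rewrite nE !lee_fin; lra.
(* If the maximal degree is [+oo], the middle and right-hand terms are both [+oo]. *)
rewrite -/h' -/n' hE nE /mul_top; case: eqP => [_|MNy].
  by split; [exact: leey|rewrite gt0_muley// lte_fin invr_gt0 ltr0n].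
have Mx x : Omega x -> ((beta_out x / m x)%:E <= max_degree m Omega)%E.
  by move=> Ox; apply: ereal_sup_ubound; exists x.
case ME: (max_degree m Omega) MNy Mx => [M| |] // _ Mx; last first.
  by have := Mx _ Ox0; rewrite leeNy_eq.
have M_gt0 : 0 < M.
  by have := Mx _ Ox0; rewrite lee_fin; apply: lt_le_trans; rewrite divr_gt0.
rewrite hE in h_ge0; split; last first.
  by rewrite -!EFinM lee_fin mulrCA ler_pM2l.
(* Dividing by [M] isolates [n'], so it suffices to bound each element of the numerical range. *)
suff : ((h ^+ 2 * 8^-1 / M)%:E <= n')%E.
  by rewrite nE -EFin_expe -!EFinM !lee_fin ler_pdivrMr// [leRHS]mulrC.
apply: le_ereal_inf_tmp => _ [_ [f [fc nf] <-] <-].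
rewrite lee_fin ler_pdivrMr// [leRHS]mulrC.
apply: numerical_range_lower => //.
  move=> U U0 UO Uf; have := hU U U0 UO Uf.
  by rewrite hE lee_fin ler_pdivlMr// vol_gt0.
by move=> x /Mx; rewrite lee_fin ler_pdivrMr.
Qed.
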